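(* Let $D^n\subset\mathbb{R}^n$ be the standard closed unit ball with $n>1$. For every $\delta>0$ there is a continuous function $f:D^n\to\mathbb{R}$ such that for each deep neural network $Net^\mu:D^n\to\mathbb{R}$ with width not greater than $n$ and with arbitrary depth, there exists $x\in D^n$ with $$\|Net^\mu(x)-f(x)\|\ge\delta,$$ provided that the activation function $\mu$ is such that for each positive integer $k$ the coordinatewise map $\mu:\mathbb{R}^k\to\mathbb{R}^k$ is group homotopic to a homeomorphism $F:\mathbb{R}^k\to F(\mathbb{R}^k)\subset\mathbb{R}^k$ (where $F$ may depend on $k$).
   Context: Activation: for a continuous scalar function $\mu:\mathbb{R}\to\mathbb{R}$, the map $\mu:\mathbb{R}^k\to\mathbb{R}^k$ is $\mu(x_1,\dots,x_k)=(\mu(x_1),\dots,\mu(x_k))$. Group homotopy: for a topological space $X$ and maps $P,Q:X\to X$, $P$ is group homotopic to $Q$ if there is a continuous $H:X\times[0,1]\to X$ with $H(x,0)=Q(x)$, $H(x,1)=P(x)$ for all $x\in X$, and $H(x,t_1+t_2)=H(H(x,t_1),t_2)$ for all $x\in X$ and all $t_1,t_2\in[0,1]$ with $t_1+t_2\in[0,1]$. Here $Q$ is the homeomorphism $F$ onto its image, regarded as a map $\mathbb{R}^k\to\mathbb{R}^k$. Deep neural network: a map $Net^\mu:\mathbb{R}^n\to\mathbb{R}^m$ ($n>m$; here $m=1$) of the form $Net^\mu=\mu\circ A_k\circ\mu\circ A_{k-1}\circ\cdots\circ\mu\circ A_1$, where $k\ge1$, $n_1=n$, $n_{k+1}=m$,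 the $n_i$ are positive integers, and each $A_i:\mathbb{R}^{n_i}\to\mathbb{R}^{n_{i+1}}$ is affine, $A_i(x)=W_ix+b_i$. Its depth is $k$ and its width is $\max\{n_i:i=1,\dots,k\}$. A network $D^n\to\mathbb{R}$ is the restriction to $D^n$ of such a map. *)

(* Defs.v *)
From HB Require Import structures.
From mathcomp Require Import all_boot all_order all_algebra.
From mathcomp Require Import all_classical all_reals all_analysis.

Set Implicit Arguments.
Unset Strict Implicit.
Unset Printing Implicit Defensive.

Import Order.TTheory GRing.Theory Num.Theory.
Import numFieldNormedType.Exports.

Local Open Scope classical_set_scope.
Local Open Scope ring_scope.

(* R^k is 'cV[R]_k.  The library norm on matrices is the sup norm; it induces
   the usual topology, but the unit ball has to be the Euclidean one. *)
Definition enorm (R : realType) (n : nat) (x : 'cV[R]_n) : R :=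
  Num.sqrt (\sum_(i < n) x i 0 ^+ 2).

Definition unit_ball (R : realType) (n : nat) : set 'cV[R]_n :=
  [set x | enorm x <= 1].

(* H : X * [0, 1] -> X is represented by a function on X * R of which only the
   restriction to X * [0, 1] is constrained. *)
Definition group_homotopic (R : realType) (X : topologicalType)
    (P Q : X -> X) : Prop :=
  exists H : X * R -> X,
    [/\ {within [set: X] `*` [set t : R | 0 <= t <= 1], continuous H},
        forall x, H (x, 0) = Q x,
        forall x, H (x, 1) = P x
      & forall x (t1 t2 : R),
          0 <= t1 <= 1 -> 0 <= t2 <= 1 -> 0 <= t1 + t2 <= 1 ->
          H (x, t1 + t2) = H (H (x, t1), t2)].

(* The inverse G is total; only its values on the image of F, with the subspace
   topology, matter. *)
Definition homeomorphism_onto_image (X Y : topologicalType) (F : X -> Y) :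
    Prop :=
  continuous F /\
  exists2 G : Y -> X, cancel F G & {within range F, continuous G}.

(* network R k n m: the data (W_1, b_1), ..., (W_k, b_k) of a network of depth k
   from R^n to R^m, first layer outermost; every dimension n_i is positive. *)
Inductive network (R : realType) : nat -> nat -> nat -> Type :=
| OneLayer (n m : nat) of (0 < n)%N & (0 < m)%N & 'M[R]_(m, n) & 'cV[R]_m :
    network R 1 n m
| FirstLayer (k n p m : nat) of (0 < n)%N & 'M[R]_(p, n) & 'cV[R]_p
    & network R k p m : network R k.+1 n m.

Fixpoint net_eval (R : realType) (mu : R -> R) (k n m : nat)
    (N : network R k n m) : 'cV[R]_n -> 'cV[R]_m :=
  match N in network _ _ n m return 'cV[R]_n -> 'cV[R]_m with
  | OneLayer _ _ _ _ W b => fun x => map_mx mu (W *m x + b)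
  | FirstLayer _ _ _ _ _ W b N' =>
      fun x => net_eval mu N' (map_mx mu (W *m x + b))
  end.

(* The maximum of n_1, ..., n_k: the output dimension n_(k+1) is not counted. *)
Fixpoint width (R : realType) (k n m : nat) (N : network R k n m) : nat :=
  match N with
  | OneLayer n _ _ _ _ _ => n
  | FirstLayer _ n _ _ _ _ _ N' => maxn n (width N')
  end.

(* Main.v *)
Require Import Defs.
From HB Require Import structures.
From mathcomp Require Import all_boot all_order all_algebra.
From mathcomp Require Import all_classical all_reals all_analysis.
From mathcomp Require Import lra.

Set Implicit Arguments.
Unset Strict Implicit.
Unset Printing Implicit Defensive.

Import Order.TTheory GRing.Theory Num.Theory.
Import numFieldNormedType.Exports.
Local Open Scope classical_set_scope.
Local Open Scope ring_scope.

(** A group homotopy is a local semiflow, and on the line the orbits of a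
    semiflow cannot cross without merging; hence the activation is
    nondecreasing ([group_homotopic_nondecreasing]), although it need not be
    injective: the time-one map may collapse an interval to a point.

    Let [N] be a network of width at most [n] on R^n with a continuous
    nondecreasing activation.  Padding every layer with zeros makes [N] the first
    coordinate of a composition of [n] by [n] layers ([net_eval_square]).
    Replacing each weight matrix [W] by [W + e I], and [mu] by [mu + e id], for
    small [e > 0], turns every layer into a homeomorphism of R^n onto itself
    ([perturbed_net_self_homeomorphism]), while moving the values on the unit
    ball by as little as desired ([perturbed_net_uniform]).

    A self-homeomorphism [Phi] of R^n with [n > 1] cannot have a first coordinate
    that separates the origin from the unit sphere: pull back by [Phi] a ray from
    [Phi 0] along which the first coordinate is constant.  The resulting path
    starts at the origin and has to leave the ball, because the image of the ball
    is bounded; where it meets the sphere, the first coordinate of [Phi] takes its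
    value at the origin ([self_homeomorphism_sphere_level]).

    So the function [4 delta |x|], which is [0] at the origin and [4 delta] on the
    sphere, is out of reach: a network within [delta] of it would be below [delta]
    at the origin and above [3 delta] on the sphere, and a perturbation of size
    less than [delta] does not close this gap. *)

(** * Continuity of matrix-valued functions and compactness of the ball *)

Lemma continuous_mx (T K : topologicalType) (m n : nat)
    (f : T -> 'M[K]_(m, n)) :
  (forall i j, continuous (fun t => f t i j)) -> continuous f.
Proof.
move=> cf t A [P Pft sPA].
suff : \forall u \near t, forall i j, P i j (f u i j).
  by apply: filterS => u Pu; exact: sPA.
by apply: filter_forall => i; apply: filter_forall => j; apply: cf; exact: Pft.
Qed.

Lemma continuous_pair (T U V : topologicalType) (f : T -> U) (g : T -> V) :
  continuous f -> continuous g -> continuous (fun t => (f t, g t)).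
Proof.
move=> cf cg t.
exact: (@cvg_pair _ _ _ (nbhs t) _ _ _ _ _ f g (cf t) (cg t)).
Qed.

Section continuous_matrix_functions.
Variables (R : realType) (T : topologicalType).

Lemma continuous_mx_entry (m n : nat) (f : T -> 'M[R]_(m, n)) i j :
  continuous f -> continuous (fun t => f t i j).
Proof.
move=> cf t; apply: (@continuous_comp _ _ _ f (fun M : 'M[R]_(m, n) => M i j)).
  exact: cf.
exact: coord_continuous.
Qed.

Lemma continuous_mulmx (m n p : nat) (f : T -> 'M[R]_(m, n))
    (g : T -> 'M[R]_(n, p)) :
  continuous f -> continuous g -> continuous (fun t => f t *m g t).
Proof.
move=> cf cg; apply: continuous_mx => i j.
under eq_fun do rewrite mxE.
apply: (continuous_big add_continuous) => k _ t.
by apply: cvgM; exact: continuous_mx_entry.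
Qed.

Lemma continuous_addmx (m n : nat) (f g : T -> 'M[R]_(m, n)) :
  continuous f -> continuous g -> continuous (fun t => f t + g t).
Proof.
move=> cf cg; apply: continuous_mx => i j; under eq_fun do rewrite mxE.
by move=> t; apply: cvgD; exact: continuous_mx_entry.
Qed.

End continuous_matrix_functions.

Lemma continuous_enorm (R : realType) (n : nat) : continuous (@enorm R n).
Proof.
move=> x; apply: (@continuous_comp _ _ _ (fun x : 'cV[R]_n =>
   \sum_(i < n) x i 0 ^+ 2) Num.sqrt); last exact: sqrt_continuous.
apply: (continuous_big add_continuous) => i _ y.
apply: (@continuous_comp _ _ _ (fun y : 'cV[R]_n => y i 0)
  (@GRing.exp R ^~ 2%N)).
  exact: coord_continuous.
exact: exprn_continuous.
Qed.

Lemma enorm0 (R : realType) (n : nat) : enorm (0 : 'cV[R]_n) = 0.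
Proof.
by rewrite /enorm big1 ?sqrtr0// => i _; rewrite mxE expr0n.
Qed.

(** The ball is closed in the cube [-1, 1]^n, which is compact as a set of row
    vectors; transposition transports it to columns. *)
Lemma compact_unit_ball (R : realType) (n : nat) : compact (@unit_ball R n).
Proof.
pose cube := [set v : 'rV[R]_n | forall i, `[(-1 : R), 1]%classic (v ord0 i)].
have cK : compact (trmx @` cube : set 'cV[R]_n).
  apply: (@continuous_compact 'rV[R]_n 'cV[R]_n trmx); last first.
    have cI (i : 'I_n) : compact `[(-1 : R), 1]%classic.
      exact: segment_compact.
    exact: (rV_compact cI).
  apply/continuous_subspaceT/continuous_mx => i j; under eq_fun do rewrite mxE.
  exact: (@coord_continuous R 1 n j i).
apply: (subclosed_compact _ cK).
  have := @closed_comp _ _ (@enorm R n) [set r | r <= 1] _ (@closed_le R 1).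
  by apply=> ? _; exact: continuous_enorm.
move=> x; rewrite /unit_ball /enorm /= => x1; exists (x^T); last exact: trmxK.
move=> i /=; rewrite mxE in_itv/= -ler_norml -sqrtr_sqr.
apply: le_trans x1; rewrite ler_sqrt ?sumr_ge0// => [|j _]; last exact: sqr_ge0.
by rewrite (bigD1 i)//= lerDl sumr_ge0// => j _; exact: sqr_ge0.
Qed.

(** * The activation is monotone *)

(** The semigroup law at times [0], [0] makes [Q] idempotent, and an injective
    idempotent map is the identity. *)
Lemma semigroup_law_start_id (R : realType) (X : topologicalType)
    (Q : X -> X) (H : X * R -> X) :
  injective Q -> (forall x, H (x, 0) = Q x) ->
  (forall x (t1 t2 : R), 0 <= t1 <= 1 -> 0 <= t2 <= 1 -> 0 <= t1 + t2 <= 1 ->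
     H (x, t1 + t2) = H (H (x, t1), t2)) ->
  forall x, H (x, 0) = x.
Proof.
move=> injQ H0 HD x; rewrite H0; apply: injQ; rewrite -!H0 -HD ?addr0 //; lra.
Qed.

(** If [x < y] but [mu y < mu x], the orbits of [x] and [y] on the line change
    order between times 0 and 1, so they meet at some time [t].  After [t] the
    semigroup law makes them coincide, hence [mu x = mu y], a contradiction. *)
Lemma group_homotopic_nondecreasing (R : realType) (mu : R -> R)
    (F : 'cV[R]_1 -> 'cV[R]_1) :
  injective F -> group_homotopic R (fun x : 'cV[R]_1 => map_mx mu x) F ->
  {homo mu : x y / x <= y}.
Proof.
move=> injF [H [cH H0 H1 HD]] x y.
have Hid := semigroup_law_start_id injF H0 HD.
rewrite le_eqVlt => /predU1P[->//|xy]; rewrite leNgt; apply/negP => muyx.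
pose orbit (z t : R) := H (const_mx z, t) 0 0.
have corbit z : {within `[0, 1], continuous (orbit z)}.
  apply/subspace_continuousP => t t01.
  apply: (@continuous_cvg _ _ _ _ _ _ (fun M : 'cV[R]_1 => M 0 0)).
    exact: coord_continuous.
  move/subspace_continuousP : cH => /(_ (const_mx z, t)) cH.
  have /cH : ([set: 'cV[R]_1] `*` [set t : R | 0 <= t <= 1]) (const_mx z, t).
    by split => //=; move: t01; rewrite /= in_itv.
  apply: cvg_comp.
  move=> A; rewrite /within /= => -[[U V] /= [Uz Vt] UVA].
  apply: filterS Vt => s Vs s01; apply: (UVA (const_mx z, s)) => /=.
    by split => //; exact: nbhs_singleton.
  by split => //=; move: s01; rewrite /= in_itv.
have [] := @IVT R (orbit y - orbit x) 0 1 0 ler01.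
- exact: within_continuousB.
- rewrite !fctE /orbit !Hid !H1 !mxE; rewrite ge_min le_max; lra.
move=> t; rewrite in_itv/= => /andP[t0 t1] /eqP; rewrite !fctE subr_eq0 => /eqP.
rewrite /orbit => yx; suff : mu y = mu x by lra.
have merge : H (const_mx y, t) = H (const_mx x, t).
  by apply/matrixP => i j; rewrite !ord1.
have split1 (z : 'cV[R]_1) : H (z, 1) = H (H (z, t), 1 - t).
  by rewrite -HD ?subrKC//; lra.
have : H (const_mx y, 1) = H (const_mx x, 1) by rewrite !split1 merge.
by rewrite !H1 => /matrixP/(_ 0 0); rewrite !mxE.
Qed.

(** * Homeomorphisms from perturbed layers *)

Definition self_homeomorphism (X : topologicalType) (f : X -> X) :=
  continuous f /\ exists g, [/\ cancel f g, cancel g f & continuous g].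

Lemma self_homeomorphism_comp (X : topologicalType) (f h : X -> X) :
  self_homeomorphism f -> self_homeomorphism h -> self_homeomorphism (h \o f).
Proof.
move=> [cf [f' [fK f'K cf']]] [ch [h' [hK h'K ch']]]; split.
  by move=> x; apply: continuous_comp; [exact: cf|exact: ch].
exists (f' \o h'); split; [exact: can_comp|exact: can_comp|].
by move=> x; apply: continuous_comp; [exact: ch'|exact: cf'].
Qed.

(** The linear term makes the map expand distances by at least the factor [e]:
    this gives injectivity and a Lipschitz inverse, and, with monotonicity,
    values that go to infinity in both directions. *)
Lemma self_homeomorphism_scalar (R : realType) (mu : R -> R) (e : R) :
  continuous mu -> {homo mu : x y / x <= y} -> 0 < e ->
  self_homeomorphism (fun s => mu s + e * s).
Proof.
move=> cmu homu e0; pose h s := mu s + e * s.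
have ch : continuous h.
  move=> s; apply: cvgD; first exact: cmu.
  by apply: cvgM; [exact: cvg_cst|exact: cvg_id].
have incr x y : x <= y -> e * (y - x) <= h y - h x.
  by move=> /homu; rewrite /h; lra.
have surj v : exists s, h s = v.
  (* At distance r from 0 the linear term alone makes up for v - mu 0. *)
  pose r := `|v - mu 0| / e.
  have r0 : 0 <= r by rewrite divr_ge0// ltW.
  have er : e * r = `|v - mu 0| by rewrite mulrC divfK// gt_eqF.
  have lo : h (- r) <= v.
    have := homu (- r) 0; rewrite oppr_le0 /h mulrN er => /(_ r0).
    by have := ler_norm (mu 0 - v); rewrite distrC; lra.
  have hi : v <= h r.
    have := homu 0 r r0; rewrite /h er.
    by have := ler_norm (v - mu 0); lra.
  have [|||s _ <-] := @IVT R h (- r) r v; last by exists s.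
  - by rewrite ge0_cp.
  - exact: continuous_subspaceT.
  - by rewrite ge_min le_max lo hi orbT.
have [g gK] := choice surj.
have expand x y : e * `|x - y| <= `|h x - h y|.
  wlog xy : x y / x <= y => [W|].
    have [/W //|/ltW /W] := leP x y; by rewrite distrC (distrC (h y)).
  rewrite distrC (distrC (h x)) ger0_norm ?subr_ge0//.
  by apply: le_trans (incr _ _ xy) _; exact: ler_norm.
have hK : cancel h g.
  move=> x; apply/eqP; rewrite -subr_eq0 -normr_le0 -(pmulr_rle0 _ e0).
  by apply: le_trans (expand _ _) _; rewrite gK subrr normr0.
split => //; exists g; split => // v.
apply/cvgrPdist_lt => d d0; near=> w.
rewrite -(ltr_pM2l e0); apply: le_lt_trans (expand _ _) _; rewrite !gK.
near: w; apply: (@cvgr_dist_lt _ _ _ (nbhs v) _ id v (@cvg_id _ _)).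
exact: mulr_gt0.
Unshelve. all: by end_near. Qed.

Lemma self_homeomorphism_map_mx (R : realType) (m n : nat) (h : R -> R) :
  self_homeomorphism h ->
  self_homeomorphism (map_mx h : 'M[R]_(m, n) -> 'M[R]_(m, n)).
Proof.
have cmap (f : R -> R) : continuous f ->
    continuous (map_mx f : 'M[R]_(m, n) -> 'M[R]_(m, n)).
  move=> cf; apply: continuous_mx => i j M.
  under eq_fun do rewrite mxE.
  by apply: (@continuous_comp _ _ _ (fun M : 'M[R]_(m, n) => M i j) f);
    [exact: coord_continuous|exact: cf].
move=> [ch [g [hK gK cg]]]; split; first exact: cmap.
exists (map_mx g); split; last exact: cmap.
  by move=> M; apply/matrixP => i j; rewrite !mxE.
by move=> M; apply/matrixP => i j; rewrite !mxE.
Qed.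

Lemma self_homeomorphism_affine (R : realType) (n : nat) (W : 'M[R]_n)
    (b : 'cV[R]_n) :
  W \in unitmx -> self_homeomorphism (fun x : 'cV[R]_n => W *m x + b).
Proof.
move=> uW; split.
  apply: continuous_addmx; last exact: cst_continuous.
  by apply: continuous_mulmx; [exact: cst_continuous|move=> x; exact: cvg_id].
exists (fun y => invmx W *m (y - b)); split.
- by move=> x; rewrite addrK mulKmx.
- by move=> x; rewrite mulKVmx// subrK.
- apply: continuous_mulmx; first exact: cst_continuous.
  by apply: continuous_addmx; [move=> y; exact: cvg_id|exact: cst_continuous].
Qed.

(** Divide out the root at 0: the cofactor is nonzero at 0, hence near 0, and the
    power of the variable vanishes only at 0. *)
Lemma horner_neq0_right (R : realType) (p : {poly R}) :
  p != 0 -> \forall e \near 0^'+, p.[e] != 0.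
Proof.
move=> p0; have [m [q q0 pE]] := multiplicity_XsubC p 0.
move/implyP : q0 => /(_ p0); rewrite rootE => q0.
near=> e; rewrite pE hornerM horner_exp hornerXsubC subr0.
rewrite mulf_neq0//; last first.
  by rewrite expf_neq0// gt_eqF//; near: e; exact: nbhs_right_gt.
near: e; apply: (@cvg_at_right_filter _ _ (horner q) 0 q.[0] _ [set x | x != 0]).
  exact: continuous_horner.
exact: (open_nbhs_nbhs (conj (@open_neq _ 0) q0)).
Unshelve. all: by end_near. Qed.

(** As a function of [e], [\det (W + e%:M)] is the characteristic polynomial of
    [- W], which is monic. *)
Lemma unitmx_addr_scalar_right (R : realType) (n : nat) (W : 'M[R]_n) :
  \forall e \near 0^'+, W + e%:M \in unitmx.
Proof.
have := @horner_neq0_right R (char_poly (- W)) (monic_neq0 (char_poly_monic _)).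
apply: filterS => e; rewrite unitmxE unitfE.
suff -> : (char_poly (- W)).[e] = \det (W + e%:M) by [].
rewrite /char_poly -horner_evalE -det_map_mx; congr (\det _).
apply/matrixP => i j; rewrite !mxE /= horner_evalE !hornerE.
by rewrite hornerMn hornerX opprK addrC.
Qed.

Section square_networks.
Variables (R : realType) (n : nat).
Implicit Types (mu : R -> R) (e : R) (x : 'cV[R]_n).

(** At [e = 0] this is a genuine layer with activation [mu].  The same parameter
    perturbs the weights and the activation, so that the composition of layers
    is one jointly continuous function of the parameter and the input. *)
Definition perturbed_layer mu e (l : 'M[R]_n * 'cV[R]_n) x : 'cV[R]_n :=
  map_mx (fun s => mu s + e * s) ((l.1 + e%:M) *m x + l.2).

Fixpoint perturbed_net mu e (ls : seq ('M[R]_n * 'cV[R]_n)) x : 'cV[R]_n :=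
  if ls is l :: ls' then perturbed_net mu e ls' (perturbed_layer mu e l x)
  else x.

Lemma continuous_perturbed_net mu ls : continuous mu ->
  continuous (fun ex : R * 'cV[R]_n => perturbed_net mu ex.1 ls ex.2).
Proof.
move=> cmu; elim: ls => [|l ls IH] [e x]; first exact: cvg_snd.
apply: (@continuous_comp _ _ _
  (fun ex : R * 'cV[R]_n => (ex.1, perturbed_layer mu ex.1 l ex.2))
  (fun ey => perturbed_net mu ey.1 ls ey.2)); last exact: IH.
move: (e, x) => {e x}; apply: continuous_pair.
  by move=> ?; exact: cvg_fst.
apply: continuous_mx => i j ex.
under eq_fun do rewrite mxE.
have cin : continuous (fun ex : R * 'cV[R]_n =>
    ((l.1 + ex.1%:M) *m ex.2 + l.2) i j).
  apply: continuous_mx_entry.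
  apply: continuous_addmx; last exact: cst_continuous.
  apply: continuous_mulmx; last by move=> ?; exact: cvg_snd.
  apply: continuous_addmx; first exact: cst_continuous.
  apply: continuous_mx => a b; under eq_fun do rewrite mxE.
  by move=> ?; apply: cvgMn; exact: cvg_fst.
apply: (@continuousD R R _
  (fun ex : R * 'cV[R]_n => mu (((l.1 + ex.1%:M) *m ex.2 + l.2) i j))
  (fun ex : R * 'cV[R]_n => ex.1 * ((l.1 + ex.1%:M) *m ex.2 + l.2) i j)).
  apply: (@continuous_comp _ _ _ _ mu); first exact: cin.
  exact: cmu.
by apply: continuousM; [exact: cvg_fst|exact: cin].
Qed.

Lemma perturbed_net_self_homeomorphism mu ls :
  continuous mu -> {homo mu : x y / x <= y} ->
  \forall e \near 0^'+, self_homeomorphism (perturbed_net mu e ls).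
Proof.
move=> cmu homu; elim: ls => [|[W b] ls IH].
  by apply: nearW => e; split => [x|]; [exact: cvg_id|exists id; split => // x;
    exact: cvg_id].
near=> e; apply: (@self_homeomorphism_comp _ (perturbed_layer mu e (W, b))).
  apply: (@self_homeomorphism_comp _ (fun x => (W + e%:M) *m x + b)).
    apply: self_homeomorphism_affine; near: e.
    exact: unitmx_addr_scalar_right.
  exact/self_homeomorphism_map_mx/self_homeomorphism_scalar.
by near: e.
Unshelve. all: by end_near. Qed.

(** Joint continuity in the parameter and the input makes the estimate local in
    the input; compactness makes it uniform. *)
Lemma perturbed_net_uniform mu ls (K : set 'cV[R]_n) (i : 'I_n) (eta : R) :
  continuous mu -> compact K -> 0 < eta ->
  \forall e \near 0^'+, forall x, K x ->
    `|perturbed_net mu e ls x i 0 - perturbed_net mu 0 ls x i 0| < eta.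
Proof.
move=> cmu /compact_near_coveringP cK eta0.
pose g (ex : R * 'cV[R]_n) : R := perturbed_net mu ex.1 ls ex.2 i 0.
have cg : continuous g.
  by apply: continuous_mx_entry; exact: continuous_perturbed_net.
have := cK R 0^'+ (fun e x => `|g (e, x) - g (0, x)| < eta) _.
apply => x Kx.
have eta2 : 0 < eta / 2 by rewrite divr_gt0.
have /cvgrPdist_lt/(_ _ eta2) [[U V] /= [U0 Vx] UVg] := cg (0, x).
exists (V, U); first by split => //; exact: cvg_within.
move=> [y e] /= [Vy Ue].
have := UVg (e, y) (conj Ue Vy).
have := UVg (0, y) (conj (nbhs_singleton U0) Vy).
by rewrite !ltr_norml; lra.
Qed.

End square_networks.

(** * The obstruction *)

(** The level set of the [i]-th coordinate through [Phi 0] contains the ray from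
    [Phi 0] in direction [j].  Its preimage under [Phi] is a path from the origin
    that leaves the ball, since the [j]-th coordinate of [Phi] is bounded there;
    the norm along this path takes the value 1. *)
Lemma self_homeomorphism_sphere_level (R : realType) (n : nat) (i j : 'I_n)
    (Phi : 'cV[R]_n -> 'cV[R]_n) :
  i != j -> self_homeomorphism Phi ->
  exists2 x, enorm x = 1 & Phi x i 0 = Phi 0 i 0.
Proof.
move=> ij [cPhi [G [PhiK GK cG]]].
have [||c _ cmax] := @compact_EVT_max _ R (fun x => Phi x j 0) _ _
  (@compact_unit_ball R n) _.
- by exists 0; rewrite /unit_ball/= enorm0.
- by apply/continuous_subspaceT/continuous_mx_entry.
(* At time T the ray is at height Phi c j 0 + 1, above the image of the ball. *)
pose T := Phi c j 0 - Phi 0 j 0 + 1.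
have T0 : 0 <= T.
  have : Phi 0 j 0 <= Phi c j 0 by apply: cmax; rewrite inE /unit_ball/= enorm0.
  by rewrite /T; lra.
pose gamma (t : R) := G (Phi 0 + t *: delta_mx j 0).
have [] := @IVT R (@enorm R n \o gamma) 0 T 1 T0.
- apply: continuous_subspaceT => t.
  apply: continuous_comp; last exact: continuous_enorm.
  apply: (@continuous_comp _ _ _ (fun t : R => Phi 0 + t *: delta_mx j 0) G);
    last exact: cG.
  move: t; apply: continuous_addmx; first exact: cst_continuous.
  apply: continuous_mx => a b; under eq_fun do rewrite mxE.
  by move=> ?; apply: cvgM; [exact: cvg_id|exact: cvg_cst].
- rewrite ge_min le_max /= {1 3}/gamma scale0r addr0 PhiK enorm0 ler01/=.
  apply/orP; right; rewrite leNgt; apply/negP => /ltW gT.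
  have := cmax (gamma T); rewrite inE => /(_ gT).
  by rewrite /gamma GK !mxE !eqxx mulr1 /T; lra.
move=> t _ gt; exists (gamma t) => //.
by rewrite /gamma GK !mxE (negbTE ij) mulr0 addr0.
Qed.

(** * Reduction to square layers *)

(** [pid_mx p] only selects coordinates, without mixing them, so any entrywise
    map, linear or not, passes through it. *)
Lemma pid_mx_mul_map (R : realType) (p n : nat) (f : R -> R) (v : 'cV[R]_n) :
  (p <= n)%N ->
  (pid_mx p : 'M[R]_(p, n)) *m map_mx f v = map_mx f (pid_mx p *m v).
Proof.
move=> pn; have entry (u : 'cV[R]_n) (a : 'I_p) :
    ((pid_mx p : 'M[R]_(p, n)) *m u) a 0 = u (widen_ord pn a) 0.
  rewrite mxE (bigD1 (widen_ord pn a))//= mxE eqxx ltn_ord mul1r.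
  rewrite big1 ?addr0// => k; rewrite -val_eqE/= eq_sym => /negbTE ka.
  by rewrite mxE ka mul0r.
by apply/matrixP => a b; rewrite !ord1 [RHS]mxE !entry mxE.
Qed.

Lemma input_le_width (R : realType) (k p m : nat) (N : network R k p m) :
  (p <= width N)%N.
Proof. by case: N => //= *; exact: leq_maxl. Qed.

(** Each layer from R^p to R^q, with [p] and [q] at most [n], becomes a layer from
    R^n to R^n that reads the first [p] coordinates and writes the first [q]; what
    it writes in the other coordinates is ignored by the layers that follow. *)
Lemma net_eval_square (R : realType) (n : nat) (mu : R -> R) (k p m : nat)
    (N : network R k p m) :
  (width N <= n)%N -> (m <= n)%N ->
  exists ls : seq ('M[R]_n * 'cV[R]_n), forall x : 'cV[R]_n,
    net_eval mu N (pid_mx p *m x) = pid_mx m *m perturbed_net mu 0 ls x.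
Proof.
pose pad q p' (W : 'M[R]_(q, p')) (b : 'cV[R]_q) : 'M[R]_n * 'cV[R]_n :=
  ((pid_mx q : 'M[R]_(n, q)) *m W *m (pid_mx p' : 'M[R]_(p', n)),
   (pid_mx q : 'M[R]_(n, q)) *m b).
have padE q p' (W : 'M[R]_(q, p')) b (x : 'cV[R]_n) : (q <= n)%N ->
    (pid_mx q : 'M[R]_(q, n)) *m perturbed_layer mu 0 (pad q p' W b) x =
    map_mx mu (W *m (pid_mx p' *m x) + b).
  move=> qn; rewrite /perturbed_layer pid_mx_mul_map// raddf0 addr0 mulmxDr.
  rewrite !mulmxA !pid_mx_id// pid_mx_1 !mul1mx.
  by apply/matrixP => a c; rewrite !mxE mul0r addr0.
elim: N => {k p m} [p m _ _ W b|k p q m _ W b N IH] /=.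
  move=> _ mn; exists [:: pad m p W b] => x /=; by rewrite padE.
rewrite geq_max => /andP[pn wN] mn; have [ls lsE] := IH wN mn.
exists (pad q p W b :: ls) => x /=; rewrite -lsE padE//.
exact: leq_trans (input_le_width N) wN.
Qed.

(** * Networks of width at most n *)

Unset Implicit Arguments.

Theorem theorem5p2 (R : realType) (n : nat) (hn : (1 < n)%N)
    (delta : R) (hdelta : 0 < delta) :
  exists2 f : 'cV[R]_n -> R,
    {within @unit_ball R n, continuous f} &
    forall mu : R -> R, continuous mu ->
      (forall k : nat, (0 < k)%N ->
        exists2 F : 'cV[R]_k -> 'cV[R]_k,
          homeomorphism_onto_image F &
          group_homotopic R (fun x : 'cV[R]_k => map_mx mu x) F) ->
      forall (k : nat) (N : network R k n 1), (width N <= n)%N ->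
        exists2 x : 'cV[R]_n, @unit_ball R n x &
          delta <= `|net_eval mu N x 0 0 - f x|.
Proof.
exists (fun x => 4 * delta * enorm x).
  apply: continuous_subspaceT => x.
  apply: (@continuous_comp _ _ _ (@enorm R n) ( *%R (4 * delta))).
    exact: continuous_enorm.
  exact: mulrl_continuous.
move=> mu cmu hmu k N wN.
have [F [_ [G FK _]] /(group_homotopic_nondecreasing (can_inj FK)) homu] :=
  hmu 1%N isT.
have [ls lsE] := net_eval_square mu wN (ltnW hn).
pose i0 := Ordinal (ltnW hn); pose i1 := Ordinal hn.
have netE x : net_eval mu N x 0 0 = perturbed_net mu 0 ls x i0 0.
  rewrite -[x in LHS]mul1mx -pid_mx_1 lsE mxE (bigD1 i0)//= mxE mul1r.
  rewrite big1 ?addr0// => a /negbTE a0.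
  by rewrite mxE eq_sym [_ == _]a0 mul0r.
apply: contrapT => noapprox.
have close x : @unit_ball R n x ->
    `|perturbed_net mu 0 ls x i0 0 - 4 * delta * enorm x| < delta.
  by move=> xb; rewrite ltNge; apply/negP => dx; apply: noapprox; exists x;
    rewrite ?netE.
have [e [/(@self_homeomorphism_sphere_level R n i0 i1) [//|x x1 xE] unif]] :
  exists e, self_homeomorphism (perturbed_net mu e ls) /\
    forall x, @unit_ball R n x ->
    `|perturbed_net mu e ls x i0 0 - perturbed_net mu 0 ls x i0 0| < delta.
  apply: (@filter_ex _ 0^'+); apply: filterI.
    exact: perturbed_net_self_homeomorphism.
  by apply: perturbed_net_uniform => //; exact: compact_unit_ball.
have b0 : @unit_ball R n 0 by rewrite /unit_ball/= enorm0.
have bx : @unit_ball R n x by rewrite /unit_ball/= x1.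
have := close _ b0; have := close _ bx; have := unif _ b0; have := unif _ bx.
rewrite xE x1 enorm0 mulr0 mulr1 subr0 !ltr_norml; lra.
Qed.
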